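(* Let $R$ be a commutative ring without zero divisors and let $F:2\mathbf{KCob}\to R\mathrm{mod}$ be a semisimple Klein TQFT with idempotent basis $\{v_\rho\}$ of $H=F(S^1)$ and structure constants $\{\lambda_\rho\}$ (i.e. $\Delta(v_\rho)=\lambda_\rho\,v_\rho\otimes v_\rho$). Then: (i) $G(v_\rho)=\lambda_\rho v_\rho$ and $C(v_\rho)=\lambda_\rho^{-1}$ for all $\rho$; (ii) $\Omega$ defines an involution $\rho\mapsto\rho^*$ on the idempotent basis: $\Omega(v_\rho)=v_{\rho^*}$; (iii) if $U=\sum_\rho U_\rho v_\rho$, then $U_\rho^2=\lambda_\rho$ if $\rho=\rho^*$, and $U_\rho=0$ if $\rho\ne\rho^*$; (iv) $K(v_\rho)=U_\rho v_\rho$ for all $\rho$.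
   Context: $2\mathbf{KCob}$ is the symmetric monoidal category whose objects are disjoint unions of copies of a fixed oriented circle $S^1$ and whose morphisms are diffeomorphism classes (rel boundary identifications) of unoriented, possibly unorientable, 2-dimensional cobordisms. A (closed 2d) Klein TQFT is a symmetric monoidal functor $F:2\mathbf{KCob}\to R\mathrm{mod}$. Equivalently it is a commutative Frobenius algebra $H=F(S^1)$ over $R$ (product $m$, coproduct $\Delta$, unit $1$, counit $C$, pairing $\langle\,,\rangle$) together with (a) an involutive (anti)automorphism $\Omega:x\mapsto x^*$ of the Frobenius algebra, i.e. $(x^* )^*=x$, $(xy)^*=y^*x^*$, $\langle x^*,y^*\rangle=\langle x,y\rangle$; and (b) an element $U\in H$ with $(aU)^*=aU$ for all $a\in H$ and $U^2=m(id\otimes\Omega)(\Delta(1))$. Here $\Omega$ is the image of the tube whose boundary identification reverses the orientation of one boundary circle, and $U$ is the image of the crosscap (Möbius band) viewed as a cobordism from $\emptyset$ to $S^1$. The Klein TQFT is semisimple if the Frobenius algebra $H$ is semisimple, i.e. $H$ has an $R$-basis $\{v_\rho\}$ with $v_\rho v_\mu=\delta_{\rho\mu}v_\rho$ (idempotent basis). The coproduct is then diagonal, $\Delta(v_\rho)=\lambda_\rho v_\rho\otimes v_\rho$, and the $\lambda_\rho$ are the structure constants. $G:H\to H$ is the genus-adding operator (image of the genus one oriented cobordism from $S^1$ to $S^1$, i.e. $m\circ\Delta$); $C:H\to R$ is the counit (image of the cup); $K:H\to H$ is the image of the tube from $S^1$ to $S^1$ with one crosscap added (a Möbius band with one disk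 removed). *)

(* Defs.v *)
From HB Require Import structures.
From mathcomp Require Import all_boot all_order all_algebra.
From mathcomp Require Import boolp.

Set Implicit Arguments.
Unset Strict Implicit.
Unset Printing Implicit Defensive.

Import GRing.Theory.
Local Open Scope ring_scope.
Local Open Scope quotient_scope.

(* MathComp has no tensor product of modules over a commutative ring.  Here    *)
(* M (x) N is the set of finite formal sums of pairs, two sums being identified *)
(* when every bilinear map gives them the same value; tlift_pure and           *)
(* tensor_ext below are its universal property.                                *)
Section TensorProduct.
Variables (R : comNzRingType) (M N : lmodType R).

Section BilinearSum.
Variables (P : lmodType R) (f : {bilinear M -> N -> P}).

Definition bsum (s : seq (M * N)) : P := \sum_(p <- s) f p.1 p.2.

Lemma bsum_cat s t : bsum (s ++ t) = bsum s + bsum t.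
Proof. by rewrite /bsum big_cat. Qed.

Lemma bsum_map (a : R) s : bsum [seq (a *: p.1, p.2) | p <- s] = a *: bsum s.
Proof.
rewrite /bsum big_map scaler_sumr; apply: eq_bigr => p _ /=.
by rewrite linearZl_LR.
Qed.
End BilinearSum.

Definition same_bsum (s t : seq (M * N)) : bool :=
  `[< forall (P : lmodType R) (f : {bilinear M -> N -> P}), bsum f s = bsum f t >].

Lemma same_bsum_equiv : equiv_class_of same_bsum.
Proof.
split.
- by move=> s; apply/asboolP.
- by move=> s t; apply/asboolP/asboolP => h P f; rewrite h.
- by move=> t s u /asboolP h1 /asboolP h2; apply/asboolP => P f; rewrite h1 h2.
Qed.

Canonical same_bsum_equivRel := EquivRelPack same_bsum_equiv.
Canonical same_bsum_encModRel := defaultEncModRel same_bsum.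

Definition tensor : Type := {eq_quot same_bsum}.
HB.instance Definition _ : EqQuotient _ same_bsum tensor := EqQuotient.on tensor.
HB.instance Definition _ := Choice.on tensor.

Definition tsum (s : seq (M * N)) : tensor := \pi_tensor s.

Lemma tsumP s t :
  (forall (P : lmodType R) (f : {bilinear M -> N -> P}), bsum f s = bsum f t) ->
  tsum s = tsum t.
Proof. by move=> h; apply/eqmodP; apply/asboolP. Qed.

Lemma bsum_repr (P : lmodType R) (f : {bilinear M -> N -> P}) s :
  bsum f (repr (tsum s)) = bsum f s.
Proof.
have /eqmodP /asboolP h : repr (tsum s) = s %[mod tensor] by rewrite reprK.
exact: h.
Qed.

Definition tensor0 := tsum [::].
Definition tensor_add (x y : tensor) := tsum (repr x ++ repr y).
Definition tensor_scale (a : R) (x : tensor) :=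
  tsum [seq (a *: p.1, p.2) | p <- repr x].
Definition tensor_opp (x : tensor) := tensor_scale (-1) x.

Local Ltac tensor_tac :=
  apply: tsumP => ? ?; rewrite ?(bsum_cat, bsum_map, bsum_repr).

Lemma tsum_repr (x : tensor) : tsum (repr x) = x. Proof. exact: reprK. Qed.

Lemma tensor_addA : associative tensor_add.
Proof. by move=> x y z; tensor_tac; rewrite addrA. Qed.

Lemma tensor_addC : commutative tensor_add.
Proof. by move=> x y; tensor_tac; rewrite addrC. Qed.

Lemma tensor_add0 : left_id tensor0 tensor_add.
Proof.
by move=> x; rewrite -[RHS]tsum_repr; tensor_tac; rewrite /bsum big_nil add0r.
Qed.

Lemma tensor_addN : left_inverse tensor0 tensor_opp tensor_add.
Proof. by move=> x; tensor_tac; rewrite scaleN1r addNr /bsum big_nil. Qed.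

HB.instance Definition _ := GRing.isZmodule.Build tensor
  tensor_addA tensor_addC tensor_add0 tensor_addN.

Lemma tensor_scaleA a b x :
  tensor_scale a (tensor_scale b x) = tensor_scale (a * b) x.
Proof. by tensor_tac; rewrite scalerA. Qed.

Lemma tensor_scale1 : left_id 1 tensor_scale.
Proof. by move=> x; rewrite -[RHS]tsum_repr; tensor_tac; rewrite scale1r. Qed.

Lemma tensor_scaleDr : right_distributive tensor_scale +%R.
Proof. by move=> a x y; tensor_tac; rewrite scalerDr. Qed.

Lemma tensor_scaleDl x : {morph tensor_scale^~ x : a b / a + b}.
Proof. by move=> a b; tensor_tac; rewrite scalerDl. Qed.

HB.instance Definition _ := GRing.Zmodule_isLmodule.Build R tensor
  tensor_scaleA tensor_scale1 tensor_scaleDr tensor_scaleDl.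

Definition tpure (x : M) (y : N) : tensor := tsum [:: (x, y)].

Lemma tpure_is_bilinear : bilinear_for
  (GRing.Scale.Law.clone _ _ *:%R _) (GRing.Scale.Law.clone _ _ *:%R _) tpure.
Proof.
split=> [y|x] a u v /=; tensor_tac; rewrite /bsum !big_seq1 /=.
- by rewrite linearPl.
- by rewrite linearPr.
Qed.

HB.instance Definition _ := bilinear_isBilinear.Build R M N tensor _ _ tpure
  tpure_is_bilinear.

Lemma tensorE (x : tensor) : x = \sum_(p <- repr x) tpure p.1 p.2.
Proof.
rewrite -[LHS]tsum_repr; elim: (repr x) => [|p s IHs]; first by rewrite big_nil.
by rewrite big_cons -IHs; tensor_tac; rewrite /bsum big_cons big_seq1.
Qed.

Lemma tensor_ext (P : lmodType R) (f g : {linear tensor -> P}) :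
  (forall x y, f (tpure x y) = g (tpure x y)) -> f =1 g.
Proof.
move=> fg x; rewrite (tensorE x) !linear_sum.
by apply: eq_bigr => p _; rewrite fg.
Qed.

Section Lift.
Variables (P : lmodType R) (f : {bilinear M -> N -> P}).

Definition tlift (x : tensor) : P := bsum f (repr x).

Lemma tlift_is_linear : linear tlift.
Proof.
by move=> a x y; rewrite /tlift bsum_repr bsum_cat bsum_repr bsum_map.
Qed.

HB.instance Definition _ := GRing.isLinear.Build R tensor P _ tlift
  tlift_is_linear.

Lemma tlift_pure x y : tlift (tpure x y) = f x y.
Proof. by rewrite /tlift bsum_repr /bsum big_seq1. Qed.
End Lift.

End TensorProduct.

Notation "x ⊗ y" := (tpure x y) (at level 40, left associativity) : ring_scope.

Section TensorMaps.
Variable R : comNzRingType.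

Section Map.
Variables (M M' N N' : lmodType R).
Variables (f : {linear M -> M'}) (g : {linear N -> N'}).

Definition tmap_fun (x : M) (y : N) : tensor M' N' := f x ⊗ g y.

Lemma tmap_fun_bilinear : bilinear_for
  (GRing.Scale.Law.clone _ _ *:%R _) (GRing.Scale.Law.clone _ _ *:%R _) tmap_fun.
Proof.
split=> [y|x] a u v /=; rewrite /tmap_fun linearP.
- by rewrite linearPl.
- by rewrite linearPr.
Qed.

HB.instance Definition _ := bilinear_isBilinear.Build R M N (tensor M' N') _ _
  tmap_fun tmap_fun_bilinear.

Definition tmap : {linear tensor M N -> tensor M' N'} := tlift tmap_fun.
End Map.

Section LeftUnitor.
Variable M : lmodType R.

Definition lunitor_fun (a : R^o) (x : M) : M := (a : R) *: x.

Lemma lunitor_fun_bilinear : bilinear_for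
  (GRing.Scale.Law.clone _ _ *:%R _) (GRing.Scale.Law.clone _ _ *:%R _)
  lunitor_fun.
Proof.
split=> [x|b] a u v /=; rewrite /lunitor_fun.
- by rewrite scalerDl scalerA.
- by rewrite scalerDr !scalerA mulrC.
Qed.

HB.instance Definition _ := bilinear_isBilinear.Build R R^o M M _ _
  lunitor_fun lunitor_fun_bilinear.

Definition lunitor : {linear tensor R^o M -> M} := tlift lunitor_fun.
End LeftUnitor.

Section RightUnitor.
Variable M : lmodType R.

Definition runitor_fun (x : M) (a : R^o) : M := (a : R) *: x.

Lemma runitor_fun_bilinear : bilinear_for
  (GRing.Scale.Law.clone _ _ *:%R _) (GRing.Scale.Law.clone _ _ *:%R _)
  runitor_fun.
Proof.
split=> [b|x] a u v /=; rewrite /runitor_fun.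
- by rewrite scalerDr !scalerA mulrC.
- by rewrite scalerDl scalerA.
Qed.

HB.instance Definition _ := bilinear_isBilinear.Build R M R^o M _ _
  runitor_fun runitor_fun_bilinear.

Definition runitor : {linear tensor M R^o -> M} := tlift runitor_fun.
End RightUnitor.

Section Associator.
Variables (M N P : lmodType R).

Section Fix_z.
Variable z : P.

Definition assoc_fun_z (x : M) (y : N) : tensor M (tensor N P) := x ⊗ (y ⊗ z).

Lemma assoc_fun_z_bilinear : bilinear_for
  (GRing.Scale.Law.clone _ _ *:%R _) (GRing.Scale.Law.clone _ _ *:%R _)
  assoc_fun_z.
Proof.
split=> [y|x] a u v /=; rewrite /assoc_fun_z.
- by rewrite linearPl.
- by rewrite linearPl linearPr.
Qed.

HB.instance Definition _ := bilinear_isBilinear.Build R M N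
  (tensor M (tensor N P)) _ _ assoc_fun_z assoc_fun_z_bilinear.
End Fix_z.

Definition assoc_fun (t : tensor M N) (z : P) : tensor M (tensor N P) :=
  tlift (assoc_fun_z z) t.

Lemma assoc_fun_bilinear : bilinear_for
  (GRing.Scale.Law.clone _ _ *:%R _) (GRing.Scale.Law.clone _ _ *:%R _)
  assoc_fun.
Proof.
split=> [z|t] a u v /=; rewrite /assoc_fun; first by rewrite linearP.
have fE z : tlift (assoc_fun_z z) t = \sum_(p <- repr t) assoc_fun_z z p.1 p.2.
  by [].
rewrite !fE scaler_sumr -big_split; apply: eq_bigr => p _ /=.
by rewrite /assoc_fun_z !linearPr.
Qed.

HB.instance Definition _ := bilinear_isBilinear.Build R (tensor M N) P
  (tensor M (tensor N P)) _ _ assoc_fun assoc_fun_bilinear.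

Definition associator :
    {linear tensor (tensor M N) P -> tensor M (tensor N P)} :=
  tlift assoc_fun.
End Associator.

Lemma tmap_pure (M M' N N' : lmodType R) (f : {linear M -> M'})
  (g : {linear N -> N'}) x y : tmap f g (x ⊗ y) = f x ⊗ g y.
Proof. exact: tlift_pure. Qed.

Lemma lunitor_pure (M : lmodType R) (a : R^o) (x : M) :
  lunitor M (a ⊗ x) = (a : R) *: x.
Proof. exact: tlift_pure. Qed.

Lemma runitor_pure (M : lmodType R) (x : M) (a : R^o) :
  runitor M (x ⊗ a) = (a : R) *: x.
Proof. exact: tlift_pure. Qed.

Lemma associator_pure (M N P : lmodType R) (x : M) (y : N) (z : P) :
  associator M N P (x ⊗ y ⊗ z) = x ⊗ (y ⊗ z).
Proof.
by apply: etrans (tlift_pure _ _ _) _; exact: tlift_pure.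
Qed.

End TensorMaps.

(* The linear map y |-> m (x (x) y). *)
Section LeftMultiplication.
Variables (R : comNzRingType) (H : lmodType R) (m : {linear tensor H H -> H}).

Definition lmulop (x y : H) : H := m (x ⊗ y).

Lemma lmulop_is_linear x : linear (lmulop x).
Proof. by move=> a y z; rewrite /lmulop linearPr linearP. Qed.

HB.instance Definition _ x := GRing.isLinear.Build R H H _ (lmulop x)
  (lmulop_is_linear x).
End LeftMultiplication.

Section KleinTQFT.
Variable R : comNzRingType.

(* The underlying object is a bare module, not a comAlgType, whose axiom      *)
(* 1 != 0 would exclude the zero algebra.                                     *)
Record comFrobenius := ComFrobenius {
  frob_mod :> lmodType R;
  frob_mul : {linear tensor frob_mod frob_mod -> frob_mod};
  frob_one : frob_mod;
  frob_comul : {linear frob_mod -> tensor frob_mod frob_mod};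
  frob_counit : {linear frob_mod -> R^o};
  frob_mulA : forall x y z,
    frob_mul (frob_mul (x ⊗ y) ⊗ z) = frob_mul (x ⊗ frob_mul (y ⊗ z));
  frob_mulC : forall x y, frob_mul (x ⊗ y) = frob_mul (y ⊗ x);
  frob_mul1 : forall x, frob_mul (frob_one ⊗ x) = x;
  frob_comulA : forall x,
    associator frob_mod frob_mod frob_mod (tmap frob_comul idfun (frob_comul x))
    = tmap idfun frob_comul (frob_comul x);
  frob_counitl : forall x,
    lunitor frob_mod (tmap frob_counit idfun (frob_comul x)) = x;
  frob_counitr : forall x,
    runitor frob_mod (tmap idfun frob_counit (frob_comul x)) = x;
  frob_relationl : forall x y,
    frob_comul (frob_mul (x ⊗ y))
    = tmap (lmulop frob_mul x) idfun (frob_comul y);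
  (* lmulop on the right-hand factor is harmless by frob_mulC *)
  frob_relationr : forall x y,
    frob_comul (frob_mul (x ⊗ y))
    = tmap idfun (lmulop frob_mul y) (frob_comul x)
}.

Definition frob_pairing (H : comFrobenius) (x y : H) : R :=
  frob_counit H (frob_mul H (x ⊗ y)).

(* A closed 2d Klein TQFT F, given by H = F(S^1) and the images of the        *)
(* generating cobordisms.  omega is the image of the orientation-reversing    *)
(* tube and crosscap the image of the Moebius band from the empty set to S^1. *)
Record kleinTQFT := KleinTQFT {
  klein_frob :> comFrobenius;
  omega : {linear klein_frob -> klein_frob};
  crosscap : klein_frob;
  omegaK : forall x, omega (omega x) = x;
  omegaM : forall x y,
    omega (frob_mul klein_frob (x ⊗ y))
    = frob_mul klein_frob (omega y ⊗ omega x);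
  omega_pairing : forall x y : klein_frob,
    frob_pairing (omega x) (omega y) = frob_pairing x y;
  omega_crosscap : forall a : klein_frob,
    omega (frob_mul klein_frob (a ⊗ crosscap))
    = frob_mul klein_frob (a ⊗ crosscap);
  crosscap_sqr :
    frob_mul klein_frob (crosscap ⊗ crosscap)
    = frob_mul klein_frob
        (tmap idfun omega (frob_comul klein_frob (frob_one klein_frob)))
}.

Definition genus_op (F : kleinTQFT) (x : F) : F :=
  frob_mul F (frob_comul F x).

(* The tube with one crosscap is a pair of pants with a Moebius band glued    *)
(* to one of its incoming circles.                                            *)
Definition crosscap_op (F : kleinTQFT) (x : F) : F :=
  frob_mul F (crosscap F ⊗ x).

(* H is finitely generated over R, since it is dualizable, so its bases are   *)
(* finite.                                                                    *)
Definition module_basis (H : lmodType R) (I : finType) (v : I -> H) : Prop :=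
  forall x : H, exists! c : {ffun I -> R}, x = \sum_i c i *: v i.

Definition idempotent_basis (H : comFrobenius) (I : finType) (v : I -> H) :
    Prop :=
  module_basis v /\
  forall i j, frob_mul H (v i ⊗ v j) = if i == j then v i else 0.

Definition structure_constants (H : comFrobenius) (I : finType) (v : I -> H)
    (lam : I -> R) : Prop :=
  forall i, frob_comul H (v i) = lam i *: (v i ⊗ v i).
End KleinTQFT.

(* Main.v *)
(* An element x of H acts on the line spanned by v i by its i-th coordinate,  *)
(* and such scalars can be cancelled.  The counit axiom on v i gives          *)
(* lam i * C (v i) = 1.  The nonzero idempotent Omega (v i) has coordinates   *)
(* in {0, 1} since R is a domain, so it absorbs some v j; applying Omega to   *)
(* v j * Omega (v i) = v j shows that Omega (v j) is a multiple of v i, hence *)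
(* equal to v i.  The crosscap axioms, read on coordinates, give the rest.    *)
Require Import Defs.
From HB Require Import structures.
From mathcomp Require Import all_boot all_order all_algebra.

Set Implicit Arguments.
Unset Strict Implicit.
Unset Printing Implicit Defensive.

Import GRing.Theory.
Local Open Scope ring_scope.

Local Notation "x ⋅ y" := (frob_mul _ (x ⊗ y))
  (at level 40, left associativity) : ring_scope.

(** Every claim reduces to scalars: [idem_mul_sum] isolates a coordinate and [idem_scale_inj]
    cancels the basis vector. [counit_structure] makes each [lam i] invertible. [omega_idem] shows
    that Omega permutes the basis; the absence of zero divisors enters there, through
    [idem_idempotent]. For the crosscap, [omega_crosscap] kills the coordinates that Omega moves,
    and [crosscap_sqr], compared with [twisted_comul_one], gives the squares of the others. *)

Section FrobeniusMul.
Variables (R : comNzRingType) (H : comFrobenius R).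
Implicit Types x y : H.

Lemma frob_mulr_sum (I : Type) (s : seq I) x (y : I -> H) :
  x ⋅ (\sum_(i <- s) y i) = \sum_(i <- s) x ⋅ y i.
Proof. exact: (linear_sum (lmulop (frob_mul H) x)). Qed.

Lemma frob_mulrZ a x y : x ⋅ (a *: y) = a *: (x ⋅ y).
Proof. by rewrite -[LHS]/(lmulop (frob_mul H) x _) linearZ. Qed.

Lemma frob_mulZr a x y : (a *: x) ⋅ y = a *: (x ⋅ y).
Proof. by rewrite frob_mulC frob_mulrZ frob_mulC. Qed.
End FrobeniusMul.

Section IdempotentBasis.
Variables (R : comNzRingType) (H : comFrobenius R) (I : finType) (v : I -> H).
Hypothesis v_basis : idempotent_basis v.

Lemma idem_mul i j : v i ⋅ v j = if i == j then v i else 0.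
Proof. exact: v_basis.2. Qed.

Lemma idem_mulii i : v i ⋅ v i = v i.
Proof. by rewrite idem_mul eqxx. Qed.

Lemma idem_mul_sum j (c : I -> R) : v j ⋅ (\sum_i c i *: v i) = c j *: v j.
Proof.
rewrite frob_mulr_sum (bigD1 j) //= frob_mulrZ idem_mulii big1 ?addr0 // => i.
by rewrite eq_sym => /negbTE ij; rewrite frob_mulrZ idem_mul ij scaler0.
Qed.

Lemma idem_expand (x : H) :
  exists c : I -> R, x = \sum_i c i *: v i /\ forall i, v i ⋅ x = c i *: v i.
Proof.
have [c [cx _]] := v_basis.1 x.
by exists c; split=> // i; rewrite cx idem_mul_sum.
Qed.

Lemma idem_scale_inj i : injective (fun a : R => a *: v i).
Proof.
(* [d c] is the coordinate vector of [c *: v i], so uniqueness of coordinates gives [d a = d b]. *)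
move=> a b /= ab; pose d c := [ffun j => if j == i then c else 0 : R].
have dE c : c *: v i = \sum_j d c j *: v j.
  rewrite (bigD1 i) //= ffunE eqxx big1 ?addr0 // => j /negbTE ji.
  by rewrite ffunE ji scale0r.
have [c [_ c_uniq]] := v_basis.1 (a *: v i).
have /ffunP/(_ i) : d a = d b.
  by rewrite -(c_uniq _ (dE a)); apply: c_uniq; rewrite ab.
by rewrite !ffunE eqxx.
Qed.

Lemma idem_neq0 i : v i <> 0.
Proof.
move=> vi0; have /eqP : 1 = 0 :> R by apply: (@idem_scale_inj i); rewrite vi0 !scaler0.
by rewrite oner_eq0.
Qed.

Lemma idem_inj : injective v.
Proof.
move=> i j vij; apply/eqP; case: eqVneq => // ij.
by case: (@idem_neq0 i); rewrite -[LHS]idem_mulii {2}vij idem_mul (negbTE ij).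
Qed.

(** Each coordinate of the unit is read off from [v i ⋅ 1 = v i]. *)
Lemma frob_one_idem : frob_one H = \sum_i v i.
Proof.
have [c [cE c1]] := idem_expand (frob_one H).
rewrite cE; apply: eq_bigr => i _; rewrite -c1.
by rewrite frob_mulC frob_mul1.
Qed.

Lemma counit_structure (lam : I -> R) i :
  structure_constants v lam -> lam i * frob_counit H (v i) = 1.
Proof.
move=> hlam; apply: (@idem_scale_inj i) => /=; rewrite scale1r.
by rewrite -[RHS]frob_counitl hlam linearZ /= tmap_pure linearZ /= lunitor_pure scalerA.
Qed.
End IdempotentBasis.

Lemma idem_idempotent (R : idomainType) (H : comFrobenius R) (I : finType)
    (v : I -> H) (c : R) i :
  idempotent_basis v -> (c *: v i) ⋅ (c *: v i) = c *: v i -> c = 0 \/ c = 1.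
Proof.
move=> hv; rewrite frob_mulrZ frob_mulZr (idem_mulii hv) scalerA.
move=> /(idem_scale_inj hv) /eqP; rewrite -subr_eq0 -{3}[c]mulr1 -mulrBr mulf_eq0.
by rewrite subr_eq0 => /orP[] /eqP; [left | right].
Qed.

Section KleinIdempotents.
Variables (R : idomainType) (F : kleinTQFT R) (I : finType) (v : I -> F).
Hypothesis v_basis : idempotent_basis v.

Lemma omega_idem i : exists j, omega F (v i) = v j.
Proof.
have omega_neq0 k : omega F (v k) <> 0.
  move=> e; apply: (idem_neq0 v_basis (i := k)).
  by rewrite -[LHS]omegaK e linear0.
have omega_sqr k : omega F (v k) ⋅ omega F (v k) = omega F (v k).
  by rewrite -omegaM (idem_mulii v_basis).
(* A product of commuting idempotents is idempotent. *)
have coord01 k l c : v l ⋅ omega F (v k) = c *: v l -> c = 0 \/ c = 1.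
  move=> e; apply: (idem_idempotent (i := l) v_basis); rewrite -e.
  rewrite frob_mulA [X in _ ⋅ X]frob_mulC frob_mulA omega_sqr -frob_mulA.
  by rewrite (idem_mulii v_basis).
have [c [cE ce]] := idem_expand v_basis (omega F (v i)).
have [j cj0] : exists j, c j != 0.
  apply/existsP; apply: contraT; rewrite negb_exists => /forallP c0.
  case: (omega_neq0 i); rewrite cE big1 // => k _.
  by have /negPn/eqP -> := c0 k; rewrite scale0r.
have cj1 : c j = 1 by case: (coord01 _ _ _ (ce j)) => // /eqP; rewrite (negbTE cj0).
(* Omega turns [v j ⋅ omega F (v i) = v j] into [v i ⋅ omega F (v j) = omega F (v j)], whose left
   side is [d i *: v i] with [d i] equal to 0 or 1; 0 is excluded because Omega is injective. *)
have := congr1 (omega F) (ce j); rewrite cj1 scale1r omegaM omegaK.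
have [d [_ de]] := idem_expand v_basis (omega F (v j)).
rewrite de => dj; case: (coord01 _ _ _ (de i)) => d_i; rewrite d_i in dj.
  by case: (omega_neq0 j); rewrite -dj scale0r.
by exists j; rewrite -[v i]scale1r dj omegaK.
Qed.

Lemma omega_star :
  exists2 star : I -> I, involutive star & forall i, omega F (v i) = v (star i).
Proof.
have hex i : exists j, omega F (v i) == v j.
  by have [j e] := omega_idem i; exists j; apply/eqP.
pose star i := xchoose (hex i).
have starE i : omega F (v i) = v (star i) by apply/eqP/(xchooseP (hex i)).
exists star => // i; apply: (idem_inj v_basis).
by rewrite -!starE omegaK.
Qed.

Variables (lam : I -> R) (star : I -> I) (u : I -> R).
Hypothesis lamE : structure_constants v lam.
Hypothesis starE : forall i, omega F (v i) = v (star i).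
Hypothesis uE : crosscap F = \sum_i u i *: v i.

Lemma idem_mul_crosscap i : v i ⋅ crosscap F = u i *: v i.
Proof. by rewrite uE (idem_mul_sum v_basis). Qed.

(** Omega fixes [v i ⋅ crosscap F = u i *: v i] but also sends it to [u i *: v (star i)], which
    [v i] annihilates. *)
Lemma crosscap_coord_nonfixed i : i <> star i -> u i = 0.
Proof.
move=> /eqP/negbTE i_star; apply: (idem_scale_inj v_basis (i := i)) => /=.
rewrite -[u i *: v i](_ : v i ⋅ (u i *: v i) = _); last first.
  by rewrite frob_mulrZ (idem_mulii v_basis).
rewrite -idem_mul_crosscap -omega_crosscap idem_mul_crosscap linearZ /= starE.
by rewrite frob_mulrZ (idem_mul v_basis) i_star scaler0 scale0r.
Qed.

(** The coproduct of 1 is the sum of the [lam i *: (v i ⊗ v i)]; after the twist, [v i ⋅ v (star i)]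
    survives only at fixed points. *)
Lemma twisted_comul_one :
  frob_mul F (tmap idfun (omega F) (frob_comul F (frob_one F)))
  = \sum_i (if i == star i then lam i else 0) *: v i.
Proof.
rewrite (frob_one_idem v_basis) [X in tmap _ _ X]linear_sum.
rewrite [X in frob_mul _ X]linear_sum linear_sum.
apply: eq_bigr => i _; rewrite lamE [tmap _ _ _]linearZ tmap_pure linearZ /=.
rewrite starE (idem_mul v_basis).
by case: ifP => _; rewrite ?scaler0 ?scale0r.
Qed.

Lemma crosscap_coord_fixed i : i = star i -> u i ^+ 2 = lam i.
Proof.
move=> i_star; apply: (idem_scale_inj v_basis (i := i)) => /=.
(* Both sides of [crosscap_sqr] are multiplied by [v i] to compare their coordinates at [i]. *)
have := idem_mul_sum v_basis i (fun j => if j == star j then lam j else 0).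
rewrite -twisted_comul_one -crosscap_sqr -i_star eqxx => <-.
by rewrite -frob_mulA idem_mul_crosscap frob_mulZr idem_mul_crosscap scalerA.
Qed.
End KleinIdempotents.

Theorem proposition7p4 (R : idomainType) (F : kleinTQFT R) (I : finType)
    (v : I -> F) (lam : I -> R)
    (hv : idempotent_basis v) (hlam : structure_constants v lam) :
  (forall i, genus_op (v i) = lam i *: v i /\
     lam i \is a GRing.unit /\ frob_counit F (v i) = (lam i)^-1) /\
  exists star : I -> I,
    [/\ involutive star,
        forall i, omega F (v i) = v (star i) &
        forall u : I -> R, crosscap F = \sum_i u i *: v i ->
          (forall i, (i = star i -> u i ^+ 2 = lam i) /\
                     (i <> star i -> u i = 0)) /\
          (forall i, crosscap_op (v i) = u i *: v i)].
Proof.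
split=> [i|].
  have lamC := counit_structure hv i hlam.
  have lam_unit : lam i \is a GRing.unit by apply/unitrPr; exists (frob_counit F (v i)).
  split; first by rewrite /genus_op hlam linearZ /= (idem_mulii hv).
  by split=> //; apply: (mulrI lam_unit); rewrite lamC divrr.
have [star starK starE] := omega_star hv; exists star; split=> // u uE.
split=> i; last by rewrite /crosscap_op frob_mulC (idem_mul_crosscap hv uE).
split.
- exact: (crosscap_coord_fixed hv hlam starE uE).
- exact: (crosscap_coord_nonfixed hv starE uE).
Qed.
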